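(* Fix $n$ and let $\pi_n$ be a prior probability mass function on $\Theta_n$ with $\pi_n(\eta)>0$ for all $\eta\in\Theta_n$. Suppose that for some $\theta\in\Theta_n$ we observe a graph $X^n$ with $n$ vertices, distributed according to $P_\theta$. Let $S\subseteq\Theta_n\setminus\{\theta\}$ be non-empty. For $\eta\in S$ define $$D_1(\theta,\eta)=\{(i,j)\in\{1,\ldots,n\}^2:\ i<j,\ \theta_i=\theta_j,\ \eta_i\neq\eta_j\},$$ $$D_2(\theta,\eta)=\{(i,j)\in\{1,\ldots,n\}^2:\ i<j,\ \theta_i\neq\theta_j,\ \eta_i=\eta_j\}.$$ Then $D_1(\theta,\eta)$ and $D_2(\theta,\eta)$ are disjoint, and if $$0<B\le\min_{\eta\in S}|D_1(\theta,\eta)\cup D_2(\theta,\eta)|,$$ then $$P_\theta\,\Pi_n(S\mid X^n)\le\rho(p_n,q_n)^{B}\sum_{\eta\in S}\frac{\pi_n(\eta)^{1/2}}{\pi_n(\theta)^{1/2}}.$$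
   Context: Parameter space: for an integer $0\le m<n/2$, $\Theta_{n,m}=\{\theta\in\{0,1\}^n:\sum_{i=1}^n\theta_i=m\}$; if $n$ is even, $\Theta_{n,n/2}=\{\theta\in\{0,1\}^n:\sum_{i=1}^n\theta_i=n/2,\ \theta_1=0\}$; and $\Theta_n=\bigcup_{m=0}^{\lfloor n/2\rfloor}\Theta_{n,m}$. Model (planted bi-section model): $p_n,q_n\in(0,1)$. $X^n$ is a random undirected graph without loops on vertex set $\{1,\ldots,n\}$, with edge indicators $X_{ij}\in\{0,1\}$, $i<j$. Under $P_\theta$, $\theta\in\Theta_n$, the $X_{ij}$ ($i<j$) are independent with $P_\theta(X_{ij}=1)=Q_{i,j}(\theta)$, where $Q_{i,j}(\theta)=p_n$ if $\theta_i=\theta_j$ and $Q_{i,j}(\theta)=q_n$ if $\theta_i\ne\theta_j$. The likelihood is $p_\theta(X^n)=\prod_{i<j}Q_{i,j}(\theta)^{X_{ij}}(1-Q_{i,j}(\theta))^{1-X_{ij}}$. Posterior: for a prior probability mass function $\pi_n$ on $\Theta_n$ and $S\subseteq\Theta_n$, $$\Pi_n(S\mid X^n)=\frac{\sum_{\theta\in S}\pi_n(\theta)p_\theta(X^n)}{\sum_{\theta\in\Theta_n}\pi_n(\theta)p_\theta(X^n)}.$$ For a real-valued function $f$ of $X^n$, $P_\theta f(X^n)$ denotes its expectation when $X^n\sim P_\theta$. $|A|$ denotes the cardinality of $A$. $\rho(p,q)=p^{1/2}q^{1/2}+(1-p)^{1/2}(1-q)^{1/2}$ is the Hellinger affinity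 of two Bernoulli distributions. *)

(* Defs.v *)
From HB Require Import structures.
From mathcomp Require Import all_boot all_order all_algebra.
From mathcomp Require Import all_classical all_reals all_analysis.

Set Implicit Arguments.
Unset Strict Implicit.
Unset Printing Implicit Defensive.

Import Order.TTheory GRing.Theory Num.Theory.
Import numFieldNormedType.Exports.

Local Open Scope classical_set_scope.
Local Open Scope ring_scope.

(* Vertices are numbered from 0: the vertex k of the mathematical text is the
   element k - 1 of 'I_n. *)
Definition labeling (n : nat) := {ffun 'I_n -> bool}.

(* The normalisation theta_1 = 0 of the balanced case only selects one of the
   two labelings that describe the same partition. *)
Definition Theta_m (n m : nat) : {set labeling n} :=
  if (m.*2 < n)%N then [set t : labeling n | (\sum_(i < n) t i)%N == m]%SET
  else if m.*2 == n then
    [set t : labeling n | ((\sum_(i < n) t i)%N == m)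
       && [forall i : 'I_n, (val i == 0%N) ==> (t i == false)]]%SET
  else finset.set0.

Definition Theta (n : nat) : {set labeling n} :=
  (\bigcup_(m < n./2.+1) Theta_m n m)%SET.

Definition edge (n : nat) := {e : 'I_n * 'I_n | (e.1 < e.2)%N}.

(* An undirected graph without loops is given by its indicators X_ij, i < j. *)
Definition graph (n : nat) := {ffun edge n -> bool}.

Definition Q (R : realType) (n : nat) (p q : R) (t : labeling n)
    (e : edge n) : R :=
  if t (val e).1 == t (val e).2 then p else q.

Definition likelihood (R : realType) (n : nat) (p q : R) (t : labeling n)
    (x : graph n) : R :=
  \prod_(e : edge n) (Q p q t e ^+ x e * (1 - Q p q t e) ^+ (1 - x e)%N).

(* X is distributed according to P_t. Every subset of bool is measurable, so
   the last clause is mutual independence of the random variables X_ij. *)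
Definition planted_bisection (d : measure_display) (Omega : measurableType d)
    (R : realType) (P : probability Omega R) (n : nat) (p q : R)
    (t : labeling n) (X : Omega -> graph n) : Prop :=
  [/\ (forall e : edge n, measurable_fun [set: Omega] (fun w => X w e)),
      (forall e : edge n, P [set w | X w e = true] = (Q p q t e)%:E)
    & (forall (J : {set edge n}) (A : edge n -> set bool),
         P [set w | forall e, e \in J -> A e (X w e)] =
         (\prod_(e in J) P [set w | A e (X w e)])%E)].

Definition is_prior (R : realType) (n : nat) (prior : labeling n -> R) : Prop :=
  (forall t, t \in Theta n -> 0 <= prior t) /\
  \sum_(t in Theta n) prior t = 1.

Definition posterior (R : realType) (n : nat) (p q : R)
    (prior : labeling n -> R) (S : {set labeling n}) (x : graph n) : R :=
  (\sum_(t in S) prior t * likelihood p q t x) /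
  (\sum_(t in Theta n) prior t * likelihood p q t x).

Definition hellinger_affinity (R : realType) (p q : R) : R :=
  Num.sqrt p * Num.sqrt q + Num.sqrt (1 - p) * Num.sqrt (1 - q).

Definition D1 (n : nat) (t u : labeling n) : {set 'I_n * 'I_n} :=
  [set e : 'I_n * 'I_n |
    [&& (e.1 < e.2)%N, t e.1 == t e.2 & u e.1 != u e.2]]%SET.

Definition D2 (n : nat) (t u : labeling n) : {set 'I_n * 'I_n} :=
  [set e : 'I_n * 'I_n |
    [&& (e.1 < e.2)%N, t e.1 != t e.2 & u e.1 == u e.2]]%SET.

(* Main.v *)
Require Import Defs.
From HB Require Import structures.
From mathcomp Require Import all_boot all_order all_algebra.
From mathcomp Require Import all_classical all_reals all_analysis.
From mathcomp Require Import measurable_realfun ring lra.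

Set Implicit Arguments.
Unset Strict Implicit.
Unset Printing Implicit Defensive.

Import Order.TTheory GRing.Theory Num.Theory.
Import numFieldNormedType.Exports.

Local Open Scope classical_set_scope.
Local Open Scope ring_scope.

(** Posterior mass concentrates because a Bayes ratio is dominated by a Hellinger
    affinity. Write L_t for the likelihood and pi for the prior. The expectation
    of the posterior of S under the true labeling theta is the finite sum, over
    graphs x and labelings eta in S, of
      pi(eta) L_eta(x) L_theta(x) / Z(x),
    where the normalising constant Z(x) is at least a + b, with
    a = pi(eta) L_eta(x) and b = pi(theta) L_theta(x), since eta and theta are
    distinct points of the parameter space. As a b / (a + b) <= sqrt (a b), the
    summand is at most
      sqrt (pi(eta) / pi(theta)) * sqrt (L_eta(x) L_theta(x))
    (likelihood_mul_posterior_le).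

    Summed over x, the last square root is the Hellinger affinity of two product
    measures, hence the product over edges of affinities of Bernoulli laws
    (sum_sqrt_likelihood). An edge contributes 1 when theta and eta agree on
    whether its end points share a label, and rho(p, q) otherwise; the latter
    edges are exactly D1 together with D2. Finally 0 < rho(p, q) <= 1, so an
    exponent that is at least B gives a power that is at most rho(p, q) ^ B.

    The passage from the expectation to a finite sum (expectation_graph) rests
    on independence, which makes the likelihood the law of the graph. *)

(** * Affinities and square roots *)

Lemma sqrtM_le_mean (R : realType) (a b : R) :
  0 <= a -> 0 <= b -> Num.sqrt a * Num.sqrt b <= (a + b) / 2.
Proof.
move=> a0 b0; have := sqr_ge0 (Num.sqrt a - Num.sqrt b).
rewrite sqrrB !sqr_sqrtr // => h; lra.
Qed.

(** The elementary inequality behind the whole bound: it trades the unknown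
    normalising constant of a posterior for a geometric mean, which factorises
    over independent observations. *)
Lemma mul_div_le_sqrt (R : realType) (a b z : R) :
  0 <= a -> 0 <= b -> 0 < z -> a + b <= z -> a * b / z <= Num.sqrt a * Num.sqrt b.
Proof.
move=> a0 b0 z0 abz; rewrite ler_pdivrMr //.
rewrite -{1}(sqr_sqrtr a0) -{1}(sqr_sqrtr b0) -exprMn expr2.
rewrite ler_wpM2l ?mulr_ge0 ?sqrtr_ge0 //.
by have := @sqrtM_le_mean _ _ _ a0 b0; lra.
Qed.

Lemma sqrt_prod (R : realType) (I : finType) (F : I -> R) :
  (forall i, 0 <= F i) -> Num.sqrt (\prod_i F i) = \prod_i Num.sqrt (F i).
Proof.
move=> F0.
have [] // : 0 <= \prod_i F i /\ Num.sqrt (\prod_i F i) = \prod_i Num.sqrt (F i).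
elim/big_rec2: _ => [|i y x _ [x0 IH]]; first by rewrite sqrtr1.
by rewrite mulr_ge0 // sqrtrM // IH.
Qed.

Lemma hellinger_affinityxx (R : realType) (p : R) :
  0 <= p <= 1 -> hellinger_affinity p p = 1.
Proof.
case/andP=> p0 p1; rewrite /hellinger_affinity -!expr2 !sqr_sqrtr ?subr_ge0 //.
by rewrite addrC subrK.
Qed.

Lemma hellinger_affinityC (R : realType) (p q : R) :
  hellinger_affinity p q = hellinger_affinity q p.
Proof. by rewrite /hellinger_affinity [X in X + _]mulrC [X in _ + X]mulrC. Qed.

Lemma hellinger_affinity_gt0 (R : realType) (p q : R) :
  0 < p < 1 -> 0 < q < 1 -> 0 < hellinger_affinity p q.
Proof.
by move=> /andP[p0 p1] /andP[q0 q1]; rewrite addr_gt0 // mulr_gt0 // sqrtr_gt0 ?subr_gt0.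
Qed.

Lemma hellinger_affinity_le1 (R : realType) (p q : R) :
  0 <= p <= 1 -> 0 <= q <= 1 -> hellinger_affinity p q <= 1.
Proof.
move=> /andP[p0 p1] /andP[q0 q1].
have := @sqrtM_le_mean _ _ _ p0 q0.
have : Num.sqrt (1 - p) * Num.sqrt (1 - q) <= (1 - p + (1 - q)) / 2.
  by apply: sqrtM_le_mean; rewrite subr_ge0.
rewrite /hellinger_affinity; lra.
Qed.

(** * Edges on which two labelings disagree *)

Lemma D1_D2_disjoint (n : nat) (t u : labeling n) : (D1 t u :&: D2 t u)%SET = finset.set0.
Proof. by apply/setP => e; rewrite !inE; case: (t e.1 == t e.2); rewrite !andbF. Qed.

(** The likelihood is indexed by the type of edges, D1 and D2 by pairs of
    vertices; this transfers the count between the two. *)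
Lemma card_D1UD2 (n : nat) (t u : labeling n) :
  #|[set e : edge n | (t (val e).1 == t (val e).2) != (u (val e).1 == u (val e).2)]%SET| =
  #|(D1 t u :|: D2 t u)%SET|.
Proof.
rewrite -(card_imset _ val_inj); apply: eq_card => e; rewrite !inE.
apply/imsetP/idP => [[f + ->]|].
  rewrite inE (valP f) /=.
  by case: (t _ == t _); case: (u _ == u _).
move=> h; have lt_e : (e.1 < e.2)%N by case/orP: h => /and3P[].
exists (exist _ e lt_e) => //; rewrite inE /=; move: h; rewrite lt_e /=.
by case: (t _ == t _); case: (u _ == u _).
Qed.

(** * Likelihoods and the posterior *)

Section likelihood.
Context {R : realType} {n : nat} (p q : R).
Hypotheses (hp : 0 < p < 1) (hq : 0 < q < 1).
Implicit Types (t u : labeling n) (e : edge n) (x : graph n).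

Lemma Q_bounds t e : 0 <= Q p q t e <= 1.
Proof.
by rewrite /Q; case: ifP => _; [case/andP: hp|case/andP: hq] => ? ?; rewrite !ltW.
Qed.

Let factor_ge0 t e (b : bool) : 0 <= Q p q t e ^+ b * (1 - Q p q t e) ^+ (1 - b)%N.
Proof. by case/andP: (Q_bounds t e) => ? ?; rewrite mulr_ge0 ?exprn_ge0 ?subr_ge0. Qed.

Lemma likelihood_ge0 t x : 0 <= likelihood p q t x.
Proof. exact: prodr_ge0. Qed.

Lemma likelihood_gt0 t x : 0 < likelihood p q t x.
Proof.
apply: prodr_gt0 => e _; rewrite /Q.
by case: ifP => _; [case/andP: hp|case/andP: hq] => ? ?;
   rewrite mulr_gt0 ?exprn_gt0 ?subr_gt0.
Qed.

(** The affinity of product measures is the product of the affinities, by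
    exchanging sum over graphs and product over edges; the edges whose success
    probability is the same under both labelings have affinity 1. *)
Lemma sum_sqrt_likelihood t u :
  \sum_x Num.sqrt (likelihood p q t x) * Num.sqrt (likelihood p q u x) =
  hellinger_affinity p q ^+ #|(D1 t u :|: D2 t u)%SET|.
Proof.
pose h v e (b : bool) := Num.sqrt (Q p q v e ^+ b * (1 - Q p q v e) ^+ (1 - b)%N).
transitivity (\sum_(x : graph n) \prod_e (h t e (x e) * h u e (x e))).
  by apply: eq_bigr => x _; rewrite /likelihood !sqrt_prod // -big_split.
rewrite -(bigA_distr_bigA (fun e b => h t e b * h u e b)).
rewrite -card_D1UD2 -prodr_const [RHS]big_mkcond; apply: eq_bigr => e _.
rewrite big_bool /h /= !expr0 !expr1 !mulr1 !mul1r.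
rewrite -/(hellinger_affinity _ _) inE.
have p1 : hellinger_affinity p p = 1.
  by apply: hellinger_affinityxx; case/andP: hp => ? ?; rewrite !ltW.
have q1 : hellinger_affinity q q = 1.
  by apply: hellinger_affinityxx; case/andP: hq => ? ?; rewrite !ltW.
rewrite /Q; case: (t _ == t _); case: (u _ == u _) => //=.
exact: hellinger_affinityC.
Qed.

(** The normalising constant dominates the sum of the two terms indexed by u
    and t, which are distinct as t is not in S; mul_div_le_sqrt then applies to
    each u separately. *)
Lemma likelihood_mul_posterior_le (prior : labeling n -> R) (t : labeling n)
    (S : {set labeling n}) x :
  (forall u, u \in Theta n -> 0 < prior u) -> t \in Theta n ->
  S \subset (Theta n :\ t)%SET ->
  posterior p q prior S x * likelihood p q t x <=
  \sum_(u in S) Num.sqrt (prior u) / Num.sqrt (prior t) *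
    (Num.sqrt (likelihood p q t x) * Num.sqrt (likelihood p q u x)).
Proof.
move=> prior_gt0 tT /fintype.subsetP ST; rewrite /posterior.
set Z := (X in _ / X); rewrite mulrAC big_distrl /= mulr_suml.
have w_gt0 u : u \in Theta n -> 0 < prior u * likelihood p q u x.
  by move=> uT; rewrite mulr_gt0 ?prior_gt0 ?likelihood_gt0.
apply: ler_sum => u /ST; rewrite !inE => /andP[ut uT].
have le_Z : prior u * likelihood p q u x + prior t * likelihood p q t x <= Z.
  rewrite /Z (bigD1 u) //= lerD2l (bigD1 t) /= 1?eq_sym ?ut ?tT // lerDl.
  by apply: sumr_ge0 => v /andP[/andP[/w_gt0/ltW]].
have Z_gt0 : 0 < Z by apply: lt_le_trans le_Z; rewrite addr_gt0 ?w_gt0.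
have := mul_div_le_sqrt (ltW (w_gt0 u uT)) (ltW (w_gt0 t tT)) Z_gt0 le_Z.
have pt := prior_gt0 t tT; have pu := prior_gt0 u uT.
(* The factor prior t, absent from the left-hand side, is restored by
   multiplying the goal by it. *)
rewrite !sqrtrM ?(ltW pt) ?(ltW pu) // -[in X in _ -> X](ler_pM2r pt).
have st : Num.sqrt (prior t) != 0 by rewrite gt_eqF ?sqrtr_gt0.
have zn : Z != 0 by rewrite gt_eqF.
congr (_ <= _); first by field.
by rewrite -[X in _ = _ * X](sqr_sqrtr (ltW pt)); field.
Qed.

End likelihood.

(** * The law of the random graph *)

Section law_of_graph.
Context {d : measure_display} {Omega : measurableType d} {R : realType}.
Context {P : probability Omega R}.

(** A finite type carries no measurable structure here, so measurability of X
    is expressed by its fibers; f (X w) is then a simple function. *)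
Lemma expectation_finite (T : finType) (X : Omega -> T) (f : T -> R) :
  (forall x, measurable (X @^-1` [set x])) -> (forall x, 0 <= f x) ->
  ('E_P[fun w => f (X w)] = \sum_x (f x)%:E * P (X @^-1` [set x]))%E.
Proof.
move=> mX f0; rewrite unlock.
under eq_integral => w _.
  have -> : f (X w) = \sum_x f x * \1_(X @^-1` [set x]) w.
    rewrite (bigD1 (X w)) //= big1 ?addr0; last first.
      move=> x xw; rewrite indicE memNset ?mulr0 // => /= wx.
      by rewrite wx eqxx in xw.
    by rewrite indicE mem_set ?mulr1.
  rewrite -sumEFin; over.
rewrite ge0_integral_sum //=.
- apply: eq_bigr => x _.
  rewrite (@integralZl_indic _ _ _ P _ measurableT (fun=> X @^-1` [set x])) //.
    by rewrite integral_indic // setIT.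
  by rewrite ltNge f0.
- by move=> x; apply/measurable_EFinP; apply: measurable_funM; last exact: measurable_indic.
- by move=> x w _; rewrite lee_fin mulr_ge0.
Qed.

Context {n : nat} {p q : R} {t : labeling n} {X : Omega -> graph n}.
Hypothesis hX : planted_bisection P p q t X.

Lemma measurable_graph_fiber (x : graph n) : measurable (X @^-1` [set x]).
Proof.
case: hX => mX _ _.
have -> : X @^-1` [set x] = \bigcap_(e in [set: edge n]) ((fun w => X w e) @^-1` [set x e]).
  apply/seteqP; split => w /=; first by move=> <-.
  by move=> h; apply/ffunP => e; apply: (h e).
apply: fin_bigcap_measurable => [|e _]; first exact: finite_finset.
by rewrite -[X in measurable X]setTI; apply: mX.
Qed.

(** Independence applied to the whole edge set and to singleton events; an
    absent edge has the complementary probability. *)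
Lemma prob_graph (x : graph n) : P (X @^-1` [set x]) = (likelihood p q t x)%:E.
Proof.
case: hX => mX X_true /(_ [set: edge n]%SET (fun e => [set x e])).
have -> : [set w | forall e, e \in [set: edge n]%SET -> [set x e] (X w e)] = X @^-1` [set x].
  apply/seteqP; split => w /=; last by move=> ->.
  by move=> h; apply/ffunP => e; apply: h; rewrite inE.
move=> ->; rewrite /likelihood -prodEFin; apply: eq_big => [e|e _]; first by rewrite inE.
case: (x e) => /=; first by rewrite expr1 mulr1 X_true.
rewrite expr0 expr1 mul1r EFinB -X_true -probability_setC.
  by congr (P _); apply/seteqP; split => w /=; case: (X w e).
by rewrite -[X in measurable X]setTI; apply: (mX e _ [set true]).
Qed.

Lemma expectation_graph (f : graph n -> R) : (forall x, 0 <= f x) ->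
  ('E_P[fun w => f (X w)])%E = (\sum_x f x * likelihood p q t x)%:E.
Proof.
move=> f0; rewrite expectation_finite //; last exact: measurable_graph_fiber.
by rewrite -sumEFin; apply: eq_bigr => x _; rewrite prob_graph.
Qed.

End law_of_graph.

Theorem proposition2p4 (R : realType) (n : nat) (p q : R)
    (hp : 0 < p < 1) (hq : 0 < q < 1)
    (prior : labeling n -> R) (hprior : is_prior prior)
    (hpos : forall eta, eta \in Theta n -> 0 < prior eta)
    (theta : labeling n) (htheta : theta \in Theta n)
    (d : measure_display) (Omega : measurableType d) (P : probability Omega R)
    (X : Omega -> graph n) (hX : planted_bisection P p q theta X)
    (S : {set labeling n}) (hS : S \subset (Theta n :\ theta)%SET)
    (hS0 : S != finset.set0) :
  (forall eta, eta \in S -> (D1 theta eta :&: D2 theta eta)%SET = finset.set0) /\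
  (forall B : R, 0 < B ->
    (forall eta, eta \in S -> B <= #|(D1 theta eta :|: D2 theta eta)%SET|%:R) ->
    ('E_P[fun w => posterior p q prior S (X w)] <=
     (hellinger_affinity p q `^ B *
      \sum_(eta in S) Num.sqrt (prior eta) / Num.sqrt (prior theta))%:E)%E).
Proof.
split=> [eta _|B B0 hB]; first exact: D1_D2_disjoint.
have ST eta : eta \in S -> eta \in Theta n by move/(fintype.subsetP hS); rewrite !inE => /andP[].
have w_ge0 eta x : eta \in Theta n -> 0 <= prior eta * likelihood p q eta x.
  by move=> /hpos/ltW ?; rewrite mulr_ge0 ?likelihood_ge0.
rewrite (expectation_graph (f := posterior p q prior S) hX); last first.
  by move=> x; rewrite divr_ge0 // sumr_ge0 // => eta => [/ST|] /w_ge0.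
rewrite lee_fin.
apply: le_trans.
  by apply: ler_sum => x _; exact: (likelihood_mul_posterior_le hp hq x hpos htheta hS).
rewrite exchange_big mulr_sumr; apply: ler_sum => eta etaS.
rewrite -mulr_sumr sum_sqrt_likelihood // mulrC ler_wpM2r ?divr_ge0 ?sqrtr_ge0 //.
have rho_gt0 := hellinger_affinity_gt0 hp hq.
rewrite -powR_mulrn ?(ltW rho_gt0) //; apply: ger_powR (hB _ etaS).
rewrite rho_gt0; case/andP: hp => ? ?; case/andP: hq => ? ?.
by rewrite hellinger_affinity_le1 ?ltW.
Qed.
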